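(* Consider the linear fractional order system $$D_t^{\gamma}x=Ax+Bu,\qquad y=Cx+Du,$$ with $\gamma\in(0,1)$, and the controller $u=Fx+Gv$, where $v$ is an external input. Let $P$ be a symmetric positive definite matrix. The closed-loop system (with input $v$ and output $y$) is passive with the storage function $V(x)=\tfrac12x^{T}Px$ if the matrices $X=P^{-1}$ and $Q=FX$ (of proper dimensions) satisfy $$\begin{bmatrix} AX+XA^{T}+BQ+Q^{T}B^{T} & BG-XC^{T}-Q^{T}D^{T}\\ (BG-XC^{T}-Q^{T}D^{T})^{T} & -DG-G^{T}D^{T}\end{bmatrix}\le 0 .$$ Consequently, given matrices $X$ (symmetric positive definite) and $Q$ satisfying this matrix inequality, the controller can be designed using $F=QX^{-1}$.
   Context: $A,B,C,D,F,G$ are constant real matrices of compatible dimensions, with $v$ and $y$ of the same dimension; $\le 0$ means negative semi-definite. For $\alpha\in(0,1)$, $D_t^{\alpha}$ is the Caputo derivative $D_t^{\alpha}g(t)=\frac{1}{\Gamma(1-\alpha)}\int_0^t (t-\tau)^{-\alpha}g'(\tau)\,d\tau$ (componentwise). A system with state $x$, input $v$, output $y$ is passive with storage function $V$ if $V$ is positive semi-definite and for some $\beta\in(0,1)$ one has $v^{T}y\ge D_t^{\beta}V(x(t))$ for all $t\ge0$ along all trajectories and for all external inputs $v$. The closed-loop system is $D_t^{\gamma}x=(A+BF)x+BGv$, $y=(C+DF)x+DGv$. *)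

(* Defs.v *)
From HB Require Import structures.
From mathcomp Require Import all_boot all_order all_algebra.
From mathcomp Require Import all_classical all_reals all_analysis.

Set Implicit Arguments.
Unset Strict Implicit.
Unset Printing Implicit Defensive.

Import Order.TTheory GRing.Theory Num.Theory.
Import numFieldNormedType.Exports.

Local Open Scope classical_set_scope.
Local Open Scope ring_scope.

Definition quad_form (R : realType) (n : nat) (M : 'M[R]_n) (x : 'cV[R]_n) : R :=
  (x^T *m M *m x) 0 0.

Definition pos_def (R : realType) (n : nat) (M : 'M[R]_n) : Prop :=
  M^T = M /\ forall x : 'cV[R]_n, x != 0 -> 0 < quad_form M x.

Definition neg_semidef (R : realType) (n : nat) (M : 'M[R]_n) : Prop :=
  M^T = M /\ forall x : 'cV[R]_n, quad_form M x <= 0.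

Definition Gamma (R : realType) (s : R) : R :=
  \int[@lebesgue_measure R]_(t in `]0, +oo[) (t `^ (s - 1) * expR (- t)).

(* The integrand is singular at tau = t; its value at that single point (0, by
   the convention on powR) is irrelevant. *)
Definition caputo_integrand (R : realType) (alpha : R) (g : R -> R) (t tau : R) : R :=
  (t - tau) `^ (- alpha) * derive1 g tau.

Definition caputo (R : realType) (alpha : R) (g : R -> R) (t : R) : R :=
  (Gamma (1 - alpha))^-1 *
  \int[@lebesgue_measure R]_(tau in `[0, t]) caputo_integrand alpha g t tau.

(* Integrals and derivatives are total operators, so the existence of the Caputo
   derivative at a point has to be stated separately. *)
Definition caputo_exists (R : realType) (alpha : R) (g : R -> R) (t : R) : Prop :=
  (@lebesgue_measure R).-integrable `[0, t]
    (fun tau => (caputo_integrand alpha g t tau)%:E).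

(* Absolute continuity on every [0, t], the usual regularity for Caputo
   derivatives: a C^1 requirement would be too strong, since solutions of
   fractional equations typically behave like t ^ gamma near 0.  Differentiability
   almost everywhere follows, by Lebesgue differentiation. *)
Definition loc_abs_continuous (R : realType) (g : R -> R) : Prop :=
  forall t : R, 0 <= t ->
    (@lebesgue_measure R).-integrable `[0, t] (fun s => (derive1 g s)%:E) /\
    g t = g 0 + \int[@lebesgue_measure R]_(s in `[0, t]) derive1 g s.

(* A system is given by its set of (input, state, output) trajectories; their
   values at negative times are irrelevant. *)
Definition io_system (R : realType) (m n p : nat) : Type :=
  (R -> 'cV[R]_m) -> (R -> 'cV[R]_n) -> (R -> 'cV[R]_p) -> Prop.

(* D_t^gamma x = A x + B u, y = C x + D u, for all t in the time domain J *)
Definition frac_lti (R : realType) (J : set R) (gamma : R) (n m p : nat)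
    (A : 'M[R]_n) (B : 'M[R]_(n, m)) (C : 'M[R]_(p, n)) (D : 'M[R]_(p, m)) :
    io_system R m n p :=
  fun u x y =>
    (forall i : 'I_n, loc_abs_continuous (fun s => x s i 0)) /\
    (forall t : R, J t ->
      [/\ forall i : 'I_n, caputo_exists gamma (fun s => x s i 0) t,
          \col_(i < n) caputo gamma (fun s => x s i 0) t = A *m x t + B *m u t
        & y t = C *m x t + D *m u t]).

Definition closed_loop (R : realType) (J : set R) (gamma : R) (n q m : nat)
    (A : 'M[R]_n) (B : 'M[R]_(n, q)) (C : 'M[R]_(m, n)) (D : 'M[R]_(m, q))
    (F : 'M[R]_(q, n)) (G : 'M[R]_(q, m)) : io_system R m n m :=
  frac_lti J gamma (A + B *m F) (B *m G) (C + D *m F) (D *m G).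

Definition pos_semidef_fun (R : realType) (n : nat) (V : 'cV[R]_n -> R) : Prop :=
  V 0 = 0 /\ forall x, 0 <= V x.

Definition passive (R : realType) (J : set R) (m n : nat)
    (S : io_system R m n m) (V : 'cV[R]_n -> R) : Prop :=
  pos_semidef_fun V /\
  exists beta : R, 0 < beta < 1 /\
    forall v x y, S v x y ->
    forall t : R, J t ->
      caputo_exists beta (V \o x) t /\
      caputo beta (V \o x) t <= ((v t)^T *m y t) 0 0.

(* At t = 0 the integral defining the Caputo derivative vanishes.  Imposing the
   state equation there constrains x 0, whereas imposing it only for t > 0 leaves
   the initial state and the value v 0 free (the natural value of the derivative
   at 0 is then a limit).  Both conventions are admitted. *)
Definition time_domain (R : realType) (J : set R) : Prop :=
  J = `[0, +oo[%classic \/ J = `]0, +oo[%classic.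

Definition passivity_lmi (R : realType) (n q m : nat)
    (A : 'M[R]_n) (B : 'M[R]_(n, q)) (C : 'M[R]_(m, n)) (D : 'M[R]_(m, q))
    (G : 'M[R]_(q, m)) (X : 'M[R]_n) (Q : 'M[R]_(q, n)) : Prop :=
  let W := B *m G - X *m C^T - Q^T *m D^T in
  neg_semidef
    (block_mx (A *m X + X *m A^T + B *m Q + Q^T *m B^T) W
              W^T (- (D *m G) - G^T *m D^T)).

(* Main.v *)
(* With P symmetric positive definite, fix t and put
   w(s) = (x(t) - x(s))^T P (x(t) - x(s)) / 2, so that w >= 0, w(t) = 0 and
   (t - s)^-gamma w'(s) = (t - s)^-gamma ((x^T P x / 2)'(s) - x(t)^T P x'(s)).
   Integrating the left-hand side over [0, t] by parts, with the singular weight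
   first replaced by the smooth increasing weight (t + 1/(n+1) - s)^-gamma, gives
   a nonpositive number; hence D^gamma (x^T P x / 2) <= x^T P D^gamma x.
   Evaluating the quadratic form of the matrix inequality at (P x, v) bounds
   x^T P D^gamma x by v^T y, so the system is passive with beta = gamma.

   Absolute continuity is handled through integral representations: if f and g
   have integrable densities, Fubini on a triangle yields one for f g, and the
   Lebesgue differentiation theorem identifies densities with derivatives
   almost everywhere. *)
Require Import Defs.
From HB Require Import structures.
From mathcomp Require Import all_boot all_order all_algebra.
From mathcomp Require Import all_classical all_reals all_analysis.
From mathcomp Require Import measurable_realfun ring lra.

Set Implicit Arguments.
Unset Strict Implicit.
Unset Printing Implicit Defensive.

Import Order.TTheory GRing.Theory Num.Theory.
Import numFieldNormedType.Exports.

Local Open Scope classical_set_scope.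
Local Open Scope ring_scope.

(** * Finite sums under the integral sign *)

Section finite_sums.
Context d (T : measurableType d) {R : realType} (mu : {measure set T -> \bar R}).

Lemma integrable_sumr (D : set T) (I : Type) (r : seq I) (F : I -> T -> R) :
  measurable D -> (forall i, mu.-integrable D (EFin \o F i)) ->
  mu.-integrable D (EFin \o (fun s => \sum_(i <- r) F i s)).
Proof.
move=> mD iF.
rewrite (_ : EFin \o _ = (fun s => \sum_(i <- r) (F i s)%:E)%E); last first.
  by apply/funext => s; rewrite /= sumEFin.
by apply: integrable_sum => // i _; exact: iF.
Qed.

Lemma Rintegral_sum (D : set T) (I : Type) (r : seq I) (F : I -> T -> R) :
  measurable D -> (forall i, mu.-integrable D (EFin \o F i)) ->
  \int[mu]_(s in D) (\sum_(i <- r) F i s) = \sum_(i <- r) \int[mu]_(s in D) F i s.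
Proof.
move=> mD iF; elim: r => [|i r IH].
  under eq_Rintegral do rewrite big_nil.
  by rewrite big_nil Rintegral_cst// mul0r.
under eq_Rintegral do rewrite big_cons.
by rewrite big_cons RintegralD ?IH//; exact: integrable_sumr.
Qed.

End finite_sums.

(** * Product kernels and Fubini on a triangle *)

Section product_kernel.
Context {R : realType}.
Notation mu := (@lebesgue_measure R).
Implicit Types a b : R -> R.

(** By Tonelli, the iterated integral of |a(x) b(y)| factors into the integrals of |a| and |b|, both
    finite. *)
Lemma integrable_tensor a b :
  mu.-integrable setT (EFin \o a) -> mu.-integrable setT (EFin \o b) ->
  (mu \x mu)%E.-integrable setT (fun z => (a z.1 * b z.2)%:E).
Proof.
move=> ia ib.
have ma : measurable_fun setT a.
  by apply/measurable_EFinP; exact: measurable_int ia.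
have mb : measurable_fun setT b.
  by apply/measurable_EFinP; exact: measurable_int ib.
apply/integrable12ltyP.
  apply/measurable_EFinP; apply: measurable_funM.
    exact: measurableT_comp ma measurable_fst.
  exact: measurableT_comp mb measurable_snd.
have iNb : (\int[mu]_y `|(b y)%:E|)%E \is a fin_num.
  by apply: integrable_fin_num => //; apply: integrable_abse.
have -> : (fun x => \int[mu]_y `|(a x * b y)%:E|)%E =
    (fun x => (fine (\int[mu]_y `|(b y)%:E|))%:E * `|(a x)%:E|)%E.
  apply/funext => x; rewrite fineK// muleC -ge0_integralZl//; last first.
    by apply: measurableT_comp => //; exact: measurable_int ib.
  by apply: eq_integral => y _; rewrite EFinM abseM.
rewrite ge0_integralZl//; last 2 first.
- by apply: measurableT_comp => //; exact: measurable_int ia.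
- by rewrite lee_fin fine_ge0// integral_ge0.
have iNa : (\int[mu]_y `|(a y)%:E|)%E \is a fin_num.
  by apply: integrable_fin_num => //; apply: integrable_abse.
by rewrite -(fineK iNa) -EFinM ltry.
Qed.

Lemma integrable_patch (I : set R) a : measurable I ->
  mu.-integrable I (EFin \o a) -> mu.-integrable setT (EFin \o (a \_ I)).
Proof.
by move=> mI ia; rewrite -restrict_EFin; exact: (integrable_mkcond (mu := mu) (EFin \o a) mI).1 ia.
Qed.

(** Both sides integrate a(s) b(r) over the triangle 0 <= s <= r <= t, in the two orders. Extending
    [a] and [b] by zero outside [0, t] moves the integral to the whole plane, where the triangle
    enters through its indicator. *)
Lemma Fubini_triangle (t : R) a b :
  mu.-integrable `[0, t] (EFin \o a) -> mu.-integrable `[0, t] (EFin \o b) ->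
  \int[mu]_(r in `[0, t]) ((\int[mu]_(s in `[0, r]) a s) * b r) =
  \int[mu]_(s in `[0, t]) (a s * \int[mu]_(r in `[s, t]) b r).
Proof.
move=> ia ib.
pose I := `[0, t]%classic : set R.
have mI : measurable I by exact: measurable_itv.
pose a' := a \_ I; pose b' := b \_ I.
have ia' : mu.-integrable setT (EFin \o a').
  exact: integrable_patch.
have ib' : mu.-integrable setT (EFin \o b').
  exact: integrable_patch.
pose T := [set z : R * R | z.1 <= z.2].
have mT : measurable T.
  rewrite -[T]setTI.
  have m12 := measurable_fun_ler (D := [set: R * R]) measurable_fst measurable_snd.
  exact: m12 measurableT [set true] _.
pose F z : \bar R := (a' z.1 * b' z.2 * \1_T z)%:E.
have iF : (mu \x mu)%E.-integrable setT F.
  apply: le_integrable (integrable_tensor ia' ib') => //.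
    apply/measurable_EFinP; apply: measurable_funM; last first.
      exact: measurable_indic.
    by apply/measurable_EFinP; exact: measurable_int (integrable_tensor ia' ib').
  move=> z _; rewrite /F /= lee_fin normrM ler_piMr//.
  by rewrite indicE; case: (_ \in _); rewrite ?normr1 ?normr0.
have {iF} := Fubini iF.
rewrite /F /=.
have sub1 r : 0 <= r <= t -> `[0, r] `<=` I.
  move=> /andP[r0 rt]; apply: subset_itvl; exact: rt.
have sub2 r : 0 <= r <= t -> `[r, t] `<=` I.
  move=> /andP[r0 rt]; apply: subset_itvr; exact: r0.
have -> : (\int[mu]_x \int[mu]_y (a' x * b' y * \1_T (x, y))%:E =
   \int[mu]_(x in I) (a x * \int[mu]_(r in `[x, t]) b r)%:E)%E.
  rewrite [RHS]integral_mkcond; apply: eq_integral => s _.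
  rewrite !patchE; case: ifPn => sI; last first.
    by apply: integral0_eq => y _; rewrite /a' patchE (negbTE sI) !mul0r.
  have sI' := set_mem sI; move: (sI'); rewrite /I/= in_itv/= => s0t.
  rewrite /a' patchE sI EFinM /Rintegral fineK; last first.
    by apply: integrable_fin_num => //; apply: integrableS ib => //; exact: sub2.
  rewrite -integralZl//; last by apply: integrableS ib => //; exact: sub2.
  rewrite [RHS]integral_mkcond; apply: eq_integral => y _.
  rewrite patchE /b' patchE indicE.
  rewrite (_ : ((s, y) \in T) = (s <= y)); last first.
    by apply/idP/idP; [move=> /set_mem|move=> ?; exact: mem_set].
  rewrite /I !mem_setE /= !in_itv /=.
  have [sy|ys] := leP s y => /=; last by rewrite mulr0.
  rewrite (le_trans (andP s0t).1 sy) /= mulr1.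
  by case: ifP; rewrite ?mulr0.
have -> : (\int[mu]_y \int[mu]_x (a' x * b' y * \1_T (x, y))%:E =
   \int[mu]_(r in I) ((\int[mu]_(s in `[0%R, r]) a s)%R * b r)%:E)%E.
  rewrite [RHS]integral_mkcond; apply: eq_integral => r _.
  rewrite !patchE; case: ifPn => rI; last first.
    by apply: integral0_eq => y _; rewrite /b' patchE (negbTE rI) mulr0 mul0r.
  have rI' := set_mem rI; move: (rI'); rewrite /I/= in_itv/= => r0t.
  rewrite /b' patchE rI EFinM /Rintegral fineK; last first.
    by apply: integrable_fin_num => //; apply: integrableS ia => //; exact: sub1.
  rewrite -integralZr//; last by apply: integrableS ia => //; exact: sub1.
  rewrite [RHS]integral_mkcond; apply: eq_integral => y _.
  rewrite patchE /a' patchE indicE.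
  rewrite (_ : ((y, r) \in T) = (y <= r)); last first.
    by apply/idP/idP; [move=> /set_mem|move=> ?; exact: mem_set].
  rewrite /I !mem_setE /= !in_itv /=.
  have [yr|ry] := leP y r => /=; last by rewrite mulr0 andbF.
  rewrite (le_trans yr (andP r0t).2) /= mulr1 andbT.
  by case: ifP; rewrite ?mul0r.
by rewrite /Rintegral => ->.
Qed.

End product_kernel.

(** * Functions with an integrable density *)

Section primitive_on.
Context {R : realType}.
Notation mu := (@lebesgue_measure R).
Implicit Types (f g a b : R -> R) (s t c : R).

(** Absolute continuity in integral form. The density is a parameter rather than [derive1 f], so
    that sums and products can be treated without any statement about differentiability. *)
Definition primitive_on t f a :=
  mu.-integrable `[0, t] (EFin \o a) /\
  forall s, 0 <= s <= t -> f s = f 0 + \int[mu]_(r in `[0, s]) a r.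

Lemma primitive_onW s t f a : s <= t -> primitive_on t f a -> primitive_on s f a.
Proof.
move=> st [ia fa]; split.
  by apply: integrableS ia => //; apply: subset_itvl.
by move=> r /andP[r0 rs]; apply: fa; rewrite r0 (le_trans rs).
Qed.

Lemma primitive_on_integral s t f a : 0 <= s <= t -> primitive_on t f a ->
  \int[mu]_(r in `[s, t]) a r = f t - f s.
Proof.
move=> /andP[s0 st] [ia fa].
rewrite (fa t) ?(le_trans s0 st)/= ?lexx// (fa s) ?s0//.
rewrite opprD addrACA subrr add0r.
rewrite Rintegral_itvB//= ?bnd_simp// Rintegral_itv_obnd_cbnd//.
apply: integrableS ia => //; apply: subset_itvr; exact: s0.
Qed.

Lemma primitive_on_continuous t f a : 0 <= t -> primitive_on t f a ->
  {within `[0, t], continuous f}.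
Proof.
move=> t0 [ia fa].
have := parameterized_integral_continuous t0 ia.
rewrite /parameterized_integral => cF.
have cF' : {within `[0, t], continuous (fun s => f 0 + \int[mu]_(r in `[0, s]) a r)}.
  by move=> x; apply: cvgD; [exact: cvg_cst|exact: cF].
apply: (subspace_eq_continuous _ cF') => s.
by rewrite inE /= in_itv/= => sI; exact/esym/fa.
Qed.

(** [f] is continuous on a compact interval, hence bounded there, and a bounded measurable factor
    preserves integrability. *)
Lemma integrable_primitive_onM t f a b : 0 <= t -> primitive_on t f a ->
  mu.-integrable `[0, t] (EFin \o b) ->
  mu.-integrable `[0, t] (EFin \o (f \* b)).
Proof.
move=> t0 pf ib.
have cf := primitive_on_continuous t0 pf.
have mf : measurable_fun `[0, t] f by exact: subspace_continuous_measurable_fun.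
apply: (integrableMr (mu := mu) _ mf _ ib) => //.
have := continuous_compact cf (segment_compact (a:=0) (b:=t)).
move=> /compact_bounded[M [Mr Mf]]; exists M; split=> // N MN x xI.
by apply: Mf => //; exists x.
Qed.

Lemma primitive_on_cst t c : primitive_on t (fun=> c) (fun=> 0).
Proof.
split; first exact: integrable0.
by move=> s _; rewrite Rintegral_cst// mul0r addr0.
Qed.

Lemma primitive_onD t f g a b : primitive_on t f a -> primitive_on t g b ->
  primitive_on t (f \+ g) (a \+ b).
Proof.
move=> [ia fa] [ib gb]; split.
  exact: (integrableD (mu := mu) _ ia ib).
move=> s /andP[s0 st]; have sub : `[0, s] `<=` `[0, t] by exact: subset_itvl.
rewrite /= RintegralD//; last 2 first.
- exact: integrableS ia.
- exact: integrableS ib.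
by rewrite (fa s) ?s0// (gb s) ?s0// addrACA.
Qed.

Lemma primitive_onZ t c f a : primitive_on t f a ->
  primitive_on t (fun s => c * f s) (fun s => c * a s).
Proof.
move=> [ia fa]; split; first exact: (integrableZl (mu := mu) _ c ia).
move=> s /andP[s0 st]; have sub : `[0, s] `<=` `[0, t] by exact: subset_itvl.
rewrite RintegralZl//; last exact: integrableS ia.
by rewrite (fa s) ?s0// mulrDr.
Qed.

Lemma primitive_on_sum t (I : Type) (r : seq I) (f a : I -> R -> R) :
  (forall i, primitive_on t (f i) (a i)) ->
  primitive_on t (fun s => \sum_(i <- r) f i s) (fun s => \sum_(i <- r) a i s).
Proof.
move=> fa; elim: r => [|i r IH].
  under eq_fun do rewrite big_nil.
  by under [X in primitive_on _ _ X]eq_fun do rewrite big_nil; exact: primitive_on_cst.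
under eq_fun do rewrite big_cons.
under [X in primitive_on _ _ X]eq_fun do rewrite big_cons.
exact: (primitive_onD (fa i) IH).
Qed.

(** Leibniz rule: in [Fubini_triangle] applied to the densities on [0, s], the inner integrals are
    f(r) - f(0) and g(s) - g(r). Expanding them gives integration by parts. *)
Lemma primitive_onM t f g a b : 0 <= t -> primitive_on t f a ->
  primitive_on t g b ->
  primitive_on t (f \* g) (fun s => a s * g s + f s * b s).
Proof.
move=> t0 pf pg.
have iag : mu.-integrable `[0, t] (EFin \o (fun s => a s * g s)).
  rewrite (_ : (fun s => a s * g s) = g \* a); last first.
    by apply/funext => s; rewrite /= mulrC.
  exact: integrable_primitive_onM pg pf.1.
have ifb := integrable_primitive_onM t0 pf pg.1.
split; first exact: (integrableD (mu := mu) _ iag ifb).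
move=> s /andP[s0 st]; have sub : `[0, s] `<=` `[0, t] by exact: subset_itvl.
have {}iag := integrableS (mu := mu) (measurable_itv _) (measurable_itv _) sub iag.
have {}ifb := integrableS (mu := mu) (measurable_itv _) (measurable_itv _) sub ifb.
move/(primitive_onW st) : pf => pf; move/(primitive_onW st) : pg => pg.
move: (Fubini_triangle pf.1 pg.1).
rewrite (_ : \int[mu]_(r in `[0, s]) (\int[mu]_(x in `[0, r]) a x * b r) =
    \int[mu]_(r in `[0, s]) (f r * b r) - f 0 * \int[mu]_(r in `[0, s]) b r); last first.
  rewrite -RintegralZl//; last exact: pg.1.
  rewrite -RintegralB//; last exact: (integrableZl (mu := mu) _ _ pg.1).
  apply: eq_Rintegral => r; rewrite inE/= in_itv/= => rs.
  by rewrite (pf.2 r) //; ring.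
rewrite (_ : \int[mu]_(r in `[0, s]) (a r * \int[mu]_(x in `[r, s]) b x) =
    g s * \int[mu]_(r in `[0, s]) a r - \int[mu]_(r in `[0, s]) (a r * g r)); last first.
  rewrite -RintegralZl//; last exact: pf.1.
  rewrite -RintegralB//; last exact: (integrableZl (mu := mu) _ _ pf.1).
  apply: eq_Rintegral => r; rewrite inE/= in_itv/= => rs.
  by rewrite (primitive_on_integral rs pg); ring.
have ss : 0 <= s <= s by rewrite s0 lexx.
have := pf.2 s ss; have := pg.2 s ss => gs fs.
rewrite RintegralD//= fs gs => /eqP.
rewrite -subr_eq0 => E; apply/eqP; rewrite -subr_eq0 -oppr_eq0; move: E.
by congr (_ == 0); ring.
Qed.

End primitive_on.

(** * Integration by parts against a singular weight *)

Section singular_weight.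
Context {R : realType}.
Notation mu := (@lebesgue_measure R).
Implicit Types (f a w : R -> R) (s t alpha : R).

Lemma primitive_on_is_derive t f a :
  (forall s, 0 <= s <= t -> is_derive s 1 f (a s)) ->
  {within `[0, t], continuous a} ->
  primitive_on t f a.
Proof.
move=> fa ca; split.
  apply: continuous_compact_integrable; first exact: segment_compact.
  exact: ca.
move=> s /andP[]; rewrite le_eqVlt => /predU1P[<- _|s0 st].
  by rewrite set_itv1 Rintegral_set1 addr0.
have fa' r : r \in `[0, s] -> is_derive r 1 f (a r).
  rewrite in_itv/= => /andP[r0 rs]; apply: fa; rewrite r0/=.
  exact: le_trans st.
have cf r : r \in `[0, s] -> {for r, continuous f}.
  by move=> /fa' dr; apply/differentiable_continuous/derivable1_diffP.
rewrite /Rintegral (@continuous_FTC2 R a f) //=.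
- ring.
- by apply: continuous_subspaceW ca; apply: subset_itvl.
- split.
  + by move=> r /subset_itv_oo_cc /fa' [].
  + by apply: cvg_at_right_filter; apply: cf; rewrite in_itv/= lexx ltW.
  + by apply: cvg_at_left_filter; apply: cf; rewrite in_itv/= lexx ltW.
- by move=> r /subset_itv_oo_cc /fa' [_ <-]; rewrite derive1E.
Qed.

Lemma is_derive_shifted_powR (c p s : R) : s < c ->
  is_derive s 1 (fun r => (c - r) `^ p) (- p * (c - s) `^ (p - 1)).
Proof.
move=> sc.
have d1 : is_derive s 1 (fun r : R => c - r) (- 1).
  by rewrite -[- 1]add0r; apply: is_deriveB.
have d2 : is_derive (c - s) 1 (@powR R ^~ p) (p * (c - s) `^ (p - 1)).
  by apply: is_derive1_powR; rewrite subr_gt0.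
have := @is_derive1_comp R (fun y => y `^ p) (fun r => c - r) s _ _ d2 d1.
by rewrite mulrN1 -mulNr.
Qed.

(** Because c > t, the base c - s stays positive on [0, t], so the weight is continuously
    differentiable up to the endpoint t. *)
Lemma primitive_on_shifted_powR (c p t : R) : t < c ->
  primitive_on t (fun s => (c - s) `^ p) (fun s => - p * (c - s) `^ (p - 1)).
Proof.
move=> tc; apply: primitive_on_is_derive => [s /andP[_ st]|].
  exact/is_derive_shifted_powR/le_lt_trans/tc.
apply: continuous_in_subspaceT => s; rewrite inE/= in_itv/= => /andP[_ st].
have /(is_derive_shifted_powR (p - 1))[d _] : s < c by exact: le_lt_trans tc.
have cd : {for s, continuous (fun r : R => (c - r) `^ (p - 1))}.
  exact/differentiable_continuous/derivable1_diffP.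
by apply: cvgM; [exact: cvg_cst|exact: cd].
Qed.

(** With k(s) = (c - s)^-alpha, integration by parts and w(t) = 0 give 0 = k(0) w(0) + int k' w +
    int k a. The first two terms are nonnegative, since k is nonnegative and increasing. *)
Lemma nonsingular_weight_integral_le0 (c alpha t : R) w a :
  0 < alpha -> 0 <= t < c -> primitive_on t w a ->
  (forall s, 0 <= s <= t -> 0 <= w s) -> w t = 0 ->
  \int[mu]_(s in `[0, t]) ((c - s) `^ (- alpha) * a s) <= 0.
Proof.
move=> alpha0 /andP[t0 tc] pw w0 wt.
have pk := primitive_on_shifted_powR (- alpha) tc.
have [_ /(_ t)] := primitive_onM t0 pk pw.
rewrite t0 lexx /= wt mulr0 => /(_ isT).
rewrite RintegralD//; last 2 first.
- set k := (k in primitive_on _ _ k) in pk.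
  rewrite (_ : (fun s => k s * w s) = w \* k); last first.
    by apply/funext => s; rewrite /= mulrC.
  exact: integrable_primitive_onM pw pk.1.
- exact: integrable_primitive_onM pk pw.1.
move=> E.
set I1 := Rintegral _ _ _ in E.
have : 0 <= I1.
  apply: Rintegral_ge0 => s /=; rewrite in_itv/= => /w0 ws.
  by rewrite mulr_ge0// mulr_ge0 ?powR_ge0// opprK ltW.
have : 0 <= (c - 0) `^ (- alpha) * w 0.
  by rewrite mulr_ge0 ?powR_ge0// w0// lexx.
move: E; lra.
Qed.

(** The regular weights with c = t + 1/(n+1) give nonpositive integrals, and these converge to the
    singular one by dominated convergence. *)
Lemma singular_weight_integral_le0 (alpha t : R) w a :
  0 < alpha -> 0 <= t -> primitive_on t w a ->
  (forall s, 0 <= s <= t -> 0 <= w s) -> w t = 0 ->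
  mu.-integrable `[0, t] (EFin \o (fun s => (t - s) `^ (- alpha) * a s)) ->
  \int[mu]_(s in `[0, t]) ((t - s) `^ (- alpha) * a s) <= 0.
Proof.
move=> alpha0 t0 pw w0 wt ika.
pose k s := (t - s) `^ (- alpha) * a s.
(* The endpoint is removed first: at s = t the regular weights blow up, whereas [powR] gives the
   singular weight the value 0 there. *)
have sub : `[0, t[%classic `<=` (`[0, t]%classic : set R) by exact: subset_itv_co_cc.
have ika' : mu.-integrable `[0, t[ (EFin \o k).
  exact: integrableS ika.
rewrite -[leLHS]/(\int[mu]_(s in `[0, t]) k s) -Rintegral_itv_bndo_bndc//.
pose K n s : R := (t + n.+1%:R^-1 - s) `^ (- alpha) * a s.
have tn n : t < t + n.+1%:R^-1 by rewrite ltrDl invr_gt0.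
have mK n : mu.-integrable `[0, t] (EFin \o K n).
  exact: integrable_primitive_onM (primitive_on_shifted_powR _ (tn n)) pw.1.
have cvgK : {ae mu, forall s, `[0, t[%classic s ->
    (EFin \o K n) s @[n --> \oo] --> (EFin \o k) s}.
  apply: aeW => s /=; rewrite in_itv/= => /andP[s0 st].
  apply: cvg_EFin; first by near=> n.
  apply: cvgM; last exact: cvg_cst.
  have ts : 0 < t - s by rewrite subr_gt0.
  have [d _] := is_derive1_powR (- alpha) ts.
  have cd : {for t - s, continuous (fun r : R => r `^ (- alpha))}.
    exact/differentiable_continuous/derivable1_diffP.
  apply: (continuous_cvg _ cd).
  rewrite -[X in _ --> X - s]addr0.
  apply: cvgB; last exact: cvg_cst.
  by apply: cvgD; [exact: cvg_cst|exact: cvg_harmonic].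
(* Moving the pole to the right enlarges the base, hence lowers the negative power; the singular
   integrand itself is the dominating function. *)
have domK : {ae mu, forall s n, `[0, t[%classic s -> (`|(EFin \o K n) s| <=
    (abse \o (EFin \o k)) s)%E}.
  apply: aeW => s n /=; rewrite in_itv/= => /andP[s0 st].
  rewrite lee_fin !normrM ler_wpM2r// !ger0_norm ?powR_ge0// !powRN.
  have ts : 0 < t - s by rewrite subr_gt0.
  have tsn : t - s <= t + n.+1%:R^-1 - s by rewrite lerD2r ltW.
  have tsn0 : 0 < t + n.+1%:R^-1 - s by exact: lt_le_trans tsn.
  rewrite lef_pV2 ?posrE ?powR_gt0//.
  by apply: ge0_ler_powR; rewrite ?nnegrE //; exact: ltW.
have [_ _ cvgI] := dominated_convergence (mu := mu) (measurable_itv _)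
  (fun n => measurable_funS (measurable_itv _) sub (measurable_int mu (mK n)))
  (measurable_int mu ika') cvgK (integrable_abse ika') domK.
rewrite /Rintegral; apply: fine_le0.
rewrite -(cvg_lim _ cvgI)//; apply: lime_le => //.
  by apply/cvg_ex; eexists; exact: cvgI.
apply: nearW => n /=.
rewrite integral_itv_bndo_bndc; last first.
  exact: measurable_funS (measurable_int mu (mK n)).
have := nonsingular_weight_integral_le0 alpha0 _ pw w0 wt.
move=> /(_ (t + n.+1%:R^-1)); rewrite t0 tn => /(_ isT).
rewrite /Rintegral => K0.
rewrite -(fineK (integrable_fin_num _ (mK n)))// lee_fin.
Unshelve. all: by end_near. Qed.

End singular_weight.

(** * Differentiability almost everywhere and measurability of the derivative *)

Section derivative.
Context {R : realType}.
Notation mu := (@lebesgue_measure R).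
Implicit Types (f a : R -> R) (t : R).

(** Almost every point is a Lebesgue point of the density extended by zero; at such a point of the
    open interval the integral has the density as its derivative. *)
Lemma primitive_on_ae_is_derive t f a : primitive_on t f a ->
  {ae mu, forall s, `]0, t[%classic s -> is_derive s 1 f (a s)}.
Proof.
move=> [ia fa].
pose b := a \_ `[0, t].
have lb : locally_integrable setT b by exact: integrable_locally.
have ib : mu.-integrable `[0, t] (EFin \o b).
  apply: eq_integrable ia => // s sI.
  by rewrite /b /= patchE sI.
have := lebesgue_differentiation lb.
apply: filterS; first exact: (ae_filter_ringOfSetsType mu).
move=> s lbs /=; rewrite in_itv/= => /andP[s0 st].
have zs : (BLeft 0%R < BRight s)%E by rewrite lte_fin.
have [] := FTC1_lebesgue_pt st ib zs lbs.
set F := fun y => _ => dF dFs.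
(* The integral representation holds only on [0, t]; 0 < s < t provides a whole neighbourhood of s
   on which it can be used. *)
have Ff : {near s, f =1 (fun y => f 0 + F y)}.
  near=> y.
  have y0 : 0 < y by near: y; exact: lt_nbhsr.
  have yt : y < t by near: y; exact: lt_nbhsl.
  rewrite fa ?ltW//; congr (_ + _); apply: eq_Rintegral => r.
  rewrite inE/= in_itv/= => /andP[r0 ry].
  by rewrite /b patchE mem_set//= in_itv/= r0 (le_trans ry)// ltW.
have cF : is_derive s 1 (fun y => f 0 + F y) (b s).
  rewrite -[b s]add0r; apply: is_deriveD.
  by apply: DeriveDef => //; rewrite -derive1E.
have -> : a s = b s by rewrite /b patchE mem_set//= in_itv/= !ltW.
apply: near_eq_is_derive cF; near=> y; apply/esym; near: y; exact: Ff.
Unshelve. all: by end_near. Qed.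

Lemma derivable1P f (s : R) :
  derivable f s 1 <-> cvg (h^-1 * (f (h + s) - f s) @[h --> 0^']).
Proof.
rewrite /derivable.
by under [in X in X <-> _]eq_fun do rewrite /= -[_ *: 1]/(_ * 1) mulr1.
Qed.

(** Cauchy criterion for difference quotients. Tolerances and radii run over the numbers 1/(n+1), so
    that the quantifiers on them become countable set operations in the measurability proof. *)
Lemma derivable_cauchyP f (s : R) : derivable f s 1 <->
  forall k : nat, exists m : nat, forall h h' : R,
    0 < `|h| < m.+1%:R^-1 -> 0 < `|h'| < m.+1%:R^-1 ->
    `|h^-1 * (f (h + s) - f s) - h'^-1 * (f (h' + s) - f s)| <= k.+1%:R^-1.
Proof.
pose q h := h^-1 * (f (h + s) - f s).
split=> [/derivable1P/cvg_ex[l ql] k|qC]; last apply/derivable1P.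
  have k0 : 0 < k.+1%:R^-1 / 2 :> R by rewrite divr_gt0 // invr_gt0.
  have /cvgrPdist_le/(_ _ k0)[/= d d0 qd] := ql.
  have [m md] : exists m, m.+1%:R^-1 < d.
    by have [m _ /(_ m (leqnn m))] := near_infty_natSinv_lt (PosNum d0); exists m.
  have qm h : 0 < `|h| < m.+1%:R^-1 -> `|l - q h| <= k.+1%:R^-1 / 2.
    move=> /andP[h0 hm]; apply: qd; last by rewrite -normr_gt0.
    by rewrite /= sub0r normrN (lt_trans hm).
  exists m => h h' /qm lh /qm lh'.
  rewrite -/(q h) -/(q h') (_ : q h - q h' = (l - q h') - (l - q h)); last ring.
  by rewrite (le_trans (ler_normB _ _))// [leRHS](splitr) lerD.
apply/cauchy_cvgP/cauchy_exP => _/posnumP[e].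
have [k ke] : exists k, k.+1%:R^-1 < e%:num.
  by have [k _ /(_ k (leqnn k))] := near_infty_natSinv_lt e; exists k.
have [m qm] := qC k.
have m0 : 0 < m.+1%:R^-1 :> R by rewrite invr_gt0.
(* The centre of the Cauchy ball is the quotient at half the radius, an admissible step. *)
exists (q (m.+1%:R^-1 / 2)).
exists m.+1%:R^-1 => //= h /=; rewrite sub0r normrN => hm h0.
apply: le_lt_trans ke; apply: qm; last by rewrite normr_gt0 h0.
by rewrite gtr0_norm ?divr_gt0//= ltr_pdivrMr// ltr_pMr// ltr1n.
Qed.

(* [lebesgue_measure] lives on the Borel sets and is not complete, so a.e. equality
   with a measurable density does not make [derive1 f] measurable.  At points
   where f is not derivable, [derive1 f] is the default value of [lim]. *)
Lemma measurable_derive1 f : continuous f -> measurable_fun setT (derive1 f).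
Proof.
move=> cf.
pose q (h s : R) := h^-1 * (f (h + s) - f s).
have cq h : continuous (q h).
  move=> s; apply: cvgM; first exact: cvg_cst.
  apply: cvgB; last exact: cf.
  apply: (continuous_cvg _ (cf (h + s))).
  by apply: cvgD; [exact: cvg_cst|exact: cvg_id].
pose D := [set s | derivable f s 1].
(* For fixed k and m the intersection over pairs of steps is uncountable, but its members are closed
   because the quotients are continuous in s; only the operations over k and m need to be
   countable. *)
have DE : D = \bigcap_k \bigcup_m \bigcap_(h in [set h : R * R |
    0 < `|h.1| < m.+1%:R^-1 /\ 0 < `|h.2| < m.+1%:R^-1])
    [set s | `|q h.1 s - q h.2 s| <= k.+1%:R^-1].
  apply/seteqP; split=> s.
    move=> /derivable_cauchyP ds k _; have [m dm] := ds k.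
    by exists m => // -[h h'] /= [hm hm']; exact: dm.
  move=> ds; apply/derivable_cauchyP => k; have [m _ dm] := ds k I.
  by exists m => h h' hm hm'; exact: (dm (h, h') (conj hm hm')).
have mD : measurable D.
  rewrite DE; apply: bigcapT_measurable => k; apply: bigcupT_measurable => m.
  apply: closed_measurable; apply: closed_bigI => -[h h'] _.
  apply: (@closed_comp _ _ (fun s => `|q h s - q h' s|) [set y | y <= k.+1%:R^-1]).
    move=> s _; apply: cvg_norm; apply: cvgB; exact: cq.
  exact: closed_le.
rewrite -(setUv D); apply/measurable_funU => //; first exact: measurableC.
split.
(* On [D] the derivative is the limit of the continuous quotients along the steps 1/(n+1). *)
- apply: (@measurable_fun_cvg _ _ _ _ (fun n => q n.+1%:R^-1)).
    by move=> n; apply: measurable_funTS; exact: continuous_measurable_fun.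
  move=> s Ds.
  have -> : derive1 f s = lim (q h s @[h --> 0^']) by [].
  have qcv : cvg (q h s @[h --> 0^']).
    exact/derivable1P.
  apply: (proj1 (cvgr_dnbhsP _ _ _) qcv); split; last exact: cvg_harmonic.
  by move=> n; rewrite invr_eq0.
- apply: (eq_measurable_fun (fun=> point)); last exact: measurable_cst.
  move=> s; rewrite inE /D /= => Ds; apply/esym/dvgP => qcv; apply: Ds.
  exact/derivable1P.
Qed.

End derivative.

(** * The Caputo derivative in terms of a density *)

Section caputo.
Context {R : realType}.
Notation mu := (@lebesgue_measure R).
Implicit Types (f d : R -> R) (alpha t : R).

(** At negative times [f] is arbitrary. Freezing it at f(0) there gives a continuous function on the
    line with the same derivative at every s > 0, and the single point 0 does not affect
    measurability. *)
Lemma measurable_derive1_ge0 f t :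
  (forall T, 0 < T -> {within `[0, T], continuous f}) ->
  measurable_fun `[0, t] (derive1 f).
Proof.
move=> cf; pose F (s : R) := f (Num.max 0 s).
have Ff (s : R) : 0 < s -> {near s, f =1 F}.
  move=> s0; near=> r; rewrite /F max_r// ltW//; near: r; exact: lt_nbhsr.
have cF : continuous F.
  move=> s; have [s0|s0|->] := ltgtP s 0; rewrite /continuous_at.
  - rewrite {2}/F max_l ?(ltW s0)//.
    have : (fun=> f 0) r @[r --> s] --> f 0 by exact: cvg_cst.
    apply: cvg_trans; apply: near_eq_cvg; near=> r.
    by rewrite /F max_l// ltW//; near: r; exact: lt_nbhsl.
  - have s1 : s < s + 1 by rewrite ltrDl.
    have [cs _ _] := (continuous_within_itvP _ (lt_trans s0 s1)).1 (cf _ (lt_trans s0 s1)).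
    have := cs s; rewrite in_itv/= s0 s1 => /(_ isT).
    rewrite {2}/F max_r ?(ltW s0)//.
    by apply: cvg_trans; apply: near_eq_cvg; exact: Ff.
  - have [_ c0 _] := (continuous_within_itvP _ ltr01).1 (cf _ ltr01).
    apply/left_right_continuousP; rewrite {2 4}/F maxxx; split.
      have : (fun=> f 0) r @[r --> (0:R)^'-] --> f 0 by exact: cvg_cst.
      apply: cvg_trans; apply: near_eq_cvg; near=> r.
      by rewrite /F max_l.
    move: c0; apply: cvg_trans; apply: near_eq_cvg; near=> r.
    by rewrite /F max_r.
apply/measurable_fun_itv_obnd_cbndP.
apply: (eq_measurable_fun (derive1 F)).
  move=> s; rewrite inE/= in_itv/= => /andP[s0 _].
  by rewrite !derive1E; apply: near_eq_derive; near=> r; apply/esym; near: r; exact: Ff.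
by apply: measurable_funTS; exact: measurable_derive1.
Unshelve. all: by end_near. Qed.

(** Any density can replace [derive1 f] under the Caputo integral, as the two agree almost
    everywhere. Measurability of the original integrand is obtained separately, from the continuity
    of [f]. *)
Lemma caputo_primitive f d alpha t : 0 <= t ->
  (forall T, 0 <= T -> primitive_on T f d) ->
  mu.-integrable `[0, t] (EFin \o (fun s => (t - s) `^ (- alpha) * d s)) ->
  caputo_exists alpha f t /\
  caputo alpha f t = (Gamma (1 - alpha))^-1 *
    \int[mu]_(s in `[0, t]) ((t - s) `^ (- alpha) * d s).
Proof.
move=> t0 pf id.
have cf T : 0 < T -> {within `[0, T], continuous f}.
  by move=> T0; apply: primitive_on_continuous (pf T (ltW T0)); exact: ltW.
have mdf : measurable_fun `[0, t] (derive1 f) by exact: measurable_derive1_ge0.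
have mK : measurable_fun `[0, t] (fun s => (t - s) `^ (- alpha)).
  apply: (measurableT_comp (measurable_powR (- alpha))).
  by apply: measurable_funB => //; exact: measurable_cst.
have mKf : measurable_fun `[0, t] (EFin \o caputo_integrand alpha f t).
  by apply/measurable_EFinP; exact: measurable_funM.
have ae0 : {ae mu, forall s : R, s <> 0}.
  exists [set 0]; split => //; first exact: lebesgue_measure_set1.
  by move=> s /= /contrapT.
have aed : ae_eq mu `[0, t]%classic (EFin \o caputo_integrand alpha f t)
    (EFin \o (fun s => (t - s) `^ (- alpha) * d s)).
  (* On the longer interval [0, t + 1] the point t is interior; the point 0 is discarded as a null
     set. *)
  have t1 : 0 <= t + 1 by rewrite addr_ge0.
  have := primitive_on_ae_is_derive (pf _ t1).
  apply: (filterS2 (ae_filter_ringOfSetsType mu)) ae0.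
  move=> s /eqP s0 ds; rewrite /= in_itv/= => /andP[s0' st].
  have := ds; rewrite /= in_itv/= lt_neqAle eq_sym s0 s0' /=.
  rewrite (le_lt_trans st) ?ltrDl// => /(_ isT) [_ dfs].
  by rewrite /caputo_integrand derive1E dfs.
have md := measurable_int mu id.
split; last first.
  rewrite /caputo /Rintegral; congr (_ * fine _).
  by apply: ae_eq_integral aed.
apply/integrableP; split => //.
have /integrableP[_] := id.
apply: le_lt_trans; rewrite le_eqVlt; apply/orP; left; apply/eqP.
apply: ae_eq_integral => //; [exact: measurableT_comp|exact: measurableT_comp|].
exact: ae_eq_abse.
Qed.

Lemma Gamma_ge0 (s : R) : 0 <= Gamma s.
Proof.
by apply: Rintegral_ge0 => x _; rewrite mulr_ge0 ?powR_ge0 ?expR_ge0.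
Qed.

End caputo.

(** * Quadratic forms along absolutely continuous trajectories *)

Section quadratic.
Context {R : realType}.
Notation mu := (@lebesgue_measure R).

Lemma bilinearE n (P : 'M[R]_n) (u v : 'cV[R]_n) :
  (u^T *m P *m v) 0 0 = \sum_i \sum_j P i j * (u i 0 * v j 0).
Proof.
rewrite -mulmxA mxE; apply: eq_bigr => i _.
rewrite !mxE big_distrr /=; apply: eq_bigr => j _.
by rewrite mulrCA.
Qed.

Lemma primitive_on_quad_form n (P : 'M[R]_n) (t : R) (f a : 'I_n -> R -> R) :
  P^T = P -> 0 <= t -> (forall i, primitive_on t (f i) (a i)) ->
  primitive_on t (fun s => 2^-1 * quad_form P (\col_i f i s))
    (fun s => \sum_i \sum_j P i j * (f i s * a j s)).
Proof.
move=> sP t0 fa.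
rewrite (_ : (fun s => 2^-1 * _) =
    (fun s => 2^-1 * \sum_i \sum_j P i j * (f i s * f j s))); last first.
  apply/funext => s; rewrite /quad_form bilinearE.
  by congr (_ * _); apply: eq_bigr => i _; apply: eq_bigr => j _; rewrite !mxE.
rewrite (_ : (fun s => \sum_i \sum_j P i j * (f i s * a j s)) =
    (fun s => 2^-1 * \sum_i \sum_j P i j * (a i s * f j s + f i s * a j s))).
  apply: primitive_onZ; apply: primitive_on_sum => i; apply: primitive_on_sum => j.
  exact: primitive_onZ (primitive_onM t0 (fa i) (fa j)).
apply/funext => s.
under [in RHS]eq_bigr => i _ do (under eq_bigr => j _ do rewrite mulrDr; rewrite big_split).
(* Swapping the two indices and using the symmetry of [P] turns the first half of the product rule
   into the second, which absorbs the factor 1/2. *)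
rewrite big_split /= [X in _ * (X + _)]exchange_big /=.
rewrite [X in _ * (X + _)](_ : _ = \sum_i \sum_j P i j * (f i s * a j s)).
  by move: (\sum_i _) => S; field.
apply: eq_bigr => j _; apply: eq_bigr => i _.
by rewrite -[in LHS]sP mxE [a i s * _]mulrC.
Qed.

Lemma caputo_quad_form_le n (P : 'M[R]_n) (x : R -> 'cV[R]_n) (alpha t : R) :
  pos_def P -> 0 < alpha -> 0 <= t ->
  (forall i, loc_abs_continuous (fun s => x s i 0)) ->
  (forall i, caputo_exists alpha (fun s => x s i 0) t) ->
  let V := fun s => 2^-1 * quad_form P (x s) in
  caputo_exists alpha V t /\
  caputo alpha V t <=
    ((x t)^T *m P *m (\col_i caputo alpha (fun s => x s i 0) t)) 0 0.
Proof.
move=> [sP pP] alpha0 t0 ax cx V.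
pose f (i : 'I_n) s := x s i 0; pose a i := derive1 (f i).
pose K s := (t - s) `^ (- alpha).
have pf T i : 0 <= T -> primitive_on T (f i) (a i).
  move=> T0; split; first exact: (ax i T T0).1.
  by move=> s /andP[s0 _]; exact: (ax i s s0).2.
have iKa i : mu.-integrable `[0, t] (EFin \o (fun s => K s * a i s)) by exact: cx.
pose d s := \sum_i \sum_j P i j * (f i s * a j s).
have pV T : 0 <= T -> primitive_on T V d.
  move=> T0.
  rewrite (_ : V = fun s => 2^-1 * quad_form P (\col_i f i s)).
    by apply: primitive_on_quad_form => // i; exact: pf.
  apply/funext => s; congr (_ * quad_form P _).
  by apply/matrixP => i j; rewrite mxE (ord1 j).
(* Each f_i is bounded on [0, t], and K a_j is integrable because the Caputo derivative of x_j
   exists at t. *)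
have iPfKa i j : mu.-integrable `[0, t]
    (EFin \o (fun s => P i j * (f i s * (K s * a j s)))).
  have := integrable_primitive_onM t0 (pf t i t0) (iKa j).
  exact: (integrableZl (mu := mu) _ (P i j)).
have KdE : (fun s => K s * d s) =
    (fun s => \sum_i \sum_j P i j * (f i s * (K s * a j s))).
  apply/funext => s; rewrite /d big_distrr; apply: eq_bigr => i _.
  by rewrite big_distrr; apply: eq_bigr => j _; rewrite /=; ring.
have iKd : mu.-integrable `[0, t] (EFin \o (fun s => K s * d s)).
  rewrite KdE; apply: integrable_sumr => // i; exact: integrable_sumr.
have [cV ->] := caputo_primitive t0 pV iKd; split => //.
(* This is (t - s)^-alpha x(t)^T P x'(s), with the state frozen at time t; by linearity its integral
   yields the right-hand side. *)
pose e s := \sum_i \sum_j (P i j * f i t) * (K s * a j s).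
have ie : mu.-integrable `[0, t] (EFin \o e).
  apply: integrable_sumr => // i; apply: integrable_sumr => // j.
  exact: (integrableZl (mu := mu) _ (P i j * f i t) (iKa j)).
have -> : ((x t)^T *m P *m (\col_i caputo alpha (fun s => x s i 0) t)) 0 0 =
    (Gamma (1 - alpha))^-1 * \int[mu]_(s in `[0, t]) e s.
  rewrite bilinearE Rintegral_sum//; last first.
    move=> i; apply: integrable_sumr => // j.
    exact: (integrableZl (mu := mu) _ (P i j * f i t) (iKa j)).
  rewrite big_distrr; apply: eq_bigr => i _ /=.
  rewrite Rintegral_sum//; last first.
    by move=> j; exact: (integrableZl (mu := mu) _ (P i j * f i t) (iKa j)).
  rewrite big_distrr; apply: eq_bigr => j _ /=.
  rewrite RintegralZl// mxE /caputo -/(f i t) /caputo_integrand.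
  by rewrite /K /a /f; ring.
apply: ler_wpM2l; first by rewrite invr_ge0 Gamma_ge0.
rewrite -subr_le0 -RintegralB//.
(* Subtracting the constant x(t) leaves the density unchanged, so [K s * d s - e s] is the weight
   times the density of the form in x(s) - x(t), which is nonnegative and vanishes at s = t. *)
pose g i s := f i s - f i t.
have pg i : primitive_on t (g i) (a i).
  have := primitive_onD (pf t i t0) (primitive_on_cst t (- f i t)).
  by congr primitive_on; apply/funext => s; rewrite /= addr0.
have KE s : K s * d s - e s = K s * \sum_i \sum_j P i j * (g i s * a j s).
  rewrite /d /e !big_distrr -sumrB; apply: eq_bigr => i _ /=.
  rewrite !big_distrr -sumrB; apply: eq_bigr => j _ /=.
  by rewrite /g; ring.
have pw := primitive_on_quad_form sP t0 pg.
rewrite (_ : \int[mu]_(s in `[0, t]) _ = \int[mu]_(s in `[0, t])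
    (K s * \sum_i \sum_j P i j * (g i s * a j s))); last first.
  by apply: eq_Rintegral => s _; exact: KE.
apply: (singular_weight_integral_le0 alpha0 t0 pw).
- move=> s _; rewrite mulr_ge0//.
  have [->|u0] := eqVneq (\col_i g i s) 0; last exact/ltW/pP.
  by rewrite /quad_form mulmx0 mxE.
- rewrite (_ : \col_i g i t = 0); first by rewrite /quad_form mulmx0 mxE mulr0.
  by apply/matrixP => i j; rewrite !mxE /g subrr.
- rewrite -[X in EFin \o X](_ : (fun s => K s * d s - e s) = _); last first.
    by apply/funext => s; exact: KE.
  exact: (integrableB (mu := mu) _ iKd ie).
Qed.

End quadratic.

(** * From the matrix inequality to the dissipation inequality *)

Section lmi.
Context {R : realType}.

(** A nonzero vector in the kernel would make the quadratic form vanish. *)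
Lemma pos_def_unitmx n (P : 'M[R]_n) : pos_def P -> P \in unitmx.
Proof.
move=> [_ pP]; rewrite -row_free_unit -kermx_eq0; apply/eqP/row_matrixP => i.
rewrite row0; apply/eqP; apply: contraT => u0.
have /pP : (row i (kermx P))^T != 0 by rewrite -trmx0 (inj_eq trmx_inj).
rewrite /quad_form trmxK (sub_kermxP (row_sub i (kermx P))) mul0mx mxE.
by rewrite ltxx.
Qed.

(** By symmetry, the form of the inverse at x is the form of [P] at [invmx P *m x]. *)
Lemma pos_def_invmx n (P : 'M[R]_n) : pos_def P -> pos_def (invmx P).
Proof.
move=> dP; have uP := pos_def_unitmx dP; have [sP pP] := dP.
have sI : (invmx P)^T = invmx P by rewrite trmx_inv sP.
split=> // x x0; have /pP : invmx P *m x != 0.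
  by apply: contra_neq x0 => Px0; rewrite -[x](mulKVmx uP) Px0 mulmx0.
by rewrite /quad_form trmx_mul sI -mulmxA mulKVmx.
Qed.

Lemma trmx11 (M : 'M[R]_1) : M^T = M.
Proof. by apply/matrixP => i j; rewrite mxE (ord1 i) (ord1 j). Qed.

(** Since X P = 1 and Q P = F, the block form at (P x, v) is exactly twice the left-hand side minus
    twice the right-hand side. *)
Lemma passivity_lmi_dissipation n q m (A : 'M[R]_n) (B : 'M[R]_(n, q))
    (C : 'M[R]_(m, n)) (D : 'M[R]_(m, q)) (G : 'M[R]_(q, m))
    (F : 'M[R]_(q, n)) (P : 'M[R]_n) (x : 'cV[R]_n) (v : 'cV[R]_m) :
  pos_def P -> passivity_lmi A B C D G (invmx P) (F *m invmx P) ->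
  (x^T *m P *m ((A + B *m F) *m x + (B *m G) *m v)) 0 0 <=
  (v^T *m ((C + D *m F) *m x + (D *m G) *m v)) 0 0.
Proof.
move=> dP [_ lmi]; have uP := pos_def_unitmx dP; have [sP _] := dP.
have := lmi (col_mx (P *m x) v).
rewrite /quad_form tr_col_mx mul_row_block mul_row_col.
rewrite !trmx_mul sP trmx_inv sP.
have trD a b (M N : 'M[R]_(a, b)) : (M + N)^T = M^T + N^T.
  by apply/matrixP => i j; rewrite !mxE.
have trN a b (M : 'M[R]_(a, b)) : (- M)^T = - M^T.
  by apply/matrixP => i j; rewrite !mxE.
rewrite !(trD, trN) !trmx_mul !trmxK !trmx_inv ?sP.
rewrite !(mulmxDl, mulmxDr, mulmxN, mulNmx).
rewrite !mulmxA.
rewrite !(mulmxK, mulmxKV, mulVmx) //.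
(* Each scalar product now occurs together with its transpose. Transposing one of each pair makes
   the matching terms syntactically equal, and linear arithmetic finishes. *)
rewrite -[x^T *m A^T *m P *m x]trmx11 -[x^T *m F^T *m B^T *m P *m x]trmx11.
rewrite -[v^T *m G^T *m B^T *m P *m x]trmx11 -[x^T *m C^T *m v]trmx11.
rewrite -[x^T *m F^T *m D^T *m v]trmx11 -[v^T *m G^T *m D^T *m v]trmx11.
rewrite !(trmx_mul, trmxK, sP, mulmxA).
have entD (M N : 'M[R]_1) : (M + N) 0 0 = M 0 0 + N 0 0 by rewrite mxE.
have entN (M : 'M[R]_1) : (- M) 0 0 = - M 0 0 by rewrite mxE.
by rewrite !(entD, entN); lra.
Qed.

End lmi.

(** * Passivity of the closed loop and controller design *)

Theorem theorem4p2 (R : realType) (J : set R) (hJ : time_domain J)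
    (n q m : nat) (gamma : R) (hgamma : 0 < gamma < 1)
    (A : 'M[R]_n) (B : 'M[R]_(n, q)) (C : 'M[R]_(m, n)) (D : 'M[R]_(m, q))
    (G : 'M[R]_(q, m)) :
  (forall (F : 'M[R]_(q, n)) (P X : 'M[R]_n) (Q : 'M[R]_(q, n)),
      pos_def P -> X = invmx P -> Q = F *m X ->
      passivity_lmi A B C D G X Q ->
      passive J (closed_loop J gamma A B C D F G)
        (fun x => 2^-1 * quad_form P x)) /\
  (forall (X : 'M[R]_n) (Q : 'M[R]_(q, n)),
      pos_def X -> passivity_lmi A B C D G X Q ->
      passive J (closed_loop J gamma A B C D (Q *m invmx X) G)
        (fun x => 2^-1 * quad_form (invmx X) x)).
Proof.
have J_ge0 t : J t -> 0 <= t.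
  by case: hJ => -> /=; rewrite in_itv/= andbT // => /ltW.
have given_P (F : 'M[R]_(q, n)) (P X : 'M[R]_n) (Q : 'M[R]_(q, n)) :
    pos_def P -> X = invmx P -> Q = F *m X -> passivity_lmi A B C D G X Q ->
    passive J (closed_loop J gamma A B C D F G) (fun x => 2^-1 * quad_form P x).
  move=> dP -> -> lmi; split.
    split=> [|x]; first by rewrite /quad_form mulmx0 mxE mulr0.
    rewrite mulr_ge0//; have [->|x0] := eqVneq x 0; last exact/ltW/dP.2.
    by rewrite /quad_form mulmx0 mxE.
  exists gamma; split=> // v x y [ax sys] t Jt.
  have [cx Dx ->] := sys t Jt.
  have gamma0 : 0 < gamma by case/andP: hgamma.
  have [cV leV] := caputo_quad_form_le dP gamma0 (J_ge0 t Jt) ax cx.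
  split=> //; apply: le_trans leV _.
  by rewrite Dx; exact: passivity_lmi_dissipation.
split=> // X Q dX lmi; have uX := pos_def_unitmx dX.
(* The design claim is the first one for P = X^-1 and F = Q X^-1: then P^-1 = X and F X = Q. *)
apply: (given_P _ _ X Q) => //; first exact: pos_def_invmx.
  by rewrite invmxK.
by rewrite mulmxKV.
Qed.
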